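(* Let $(a,b)$ be a pair of nonnegative integers, not both $0$. Every digitally convex word with Parikh vector $(a,b)$ can be obtained from the lower Christoffel word $w_{a,b}$ by a (finite, possibly empty) sequence of applications of the inflation operation, and every digitally convex word with Parikh vector $(a,b)$ can be obtained from the word $1^b0^a$ by a (finite, possibly empty) sequence of applications of the deflation operation.
   Context: Words are over $\{0,1\}$. The Parikh vector of $w$ is $(|w|_0,|w|_1)$, where $|w|_x$ is the number of occurrences of the letter $x$. A word $w$ encodes a lattice path starting at $(0,0)$, where $0$ is a horizontal unit step (to the right) and $1$ is a vertical unit step (upwards). Lower Christoffel word $w_{a,b}$: the word encoding the path from $(0,0)$ to $(a,b)$ that is closest from below to the Euclidean segment joining $(0,0)$ to $(a,b)$, without crossing it (the path lies weakly below the segment and no lattice point lies strictly above the path and weakly below the segment). In particular $w_{n,0}=0^n$, $w_{0,n}=1^n$. A word is balanced if the numbers of $0$s in any two of its factors of the same length differ by at most $1$. A Lyndon word (for the order $0<1$) is a primitive word (nonempty and not a proper power of a shorter word) that is lexicographically smaller than all its other conjugates; every word has a unique factorization as a lexicographically non-increasing product of Lyndon words, its Lyndon factorization. A word with Parikh vector $(a,b)$ is (upward) digitally convex if it is the best approximation from below of an upward convex curve joining $(0,0)$ and $(a,b)$ and contained in the rectangle with opposite vertices $(0,0)$ and $(a,b)$. By a known characterization (Brlek et al.), which may be taken as the definition, a word is digitally convex if and only if all Lyndon words in its Lyndon factorization are balanced. Inflation: an application of inflation changes a digitally convex word $u01v$ into the word $u10v$, provided that $u10v$ is also digitally convex. Deflation: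 an application of deflation changes a digitally convex word $u10v$ into the word $u01v$, provided that $u01v$ is also digitally convex. (Here $u,v$ are arbitrary words.) *)

(* Defs.v *)
From mathcomp Require Import all_boot all_order zify.
From Stdlib Require Import Relation_Operators.

Set Implicit Arguments.
Unset Strict Implicit.
Unset Printing Implicit Defensive.

(* The letter 0 (horizontal step) is [false], the letter 1 (vertical step) is
   [true]; the order of MathComp on [bool] is then 0 < 1. *)
Notation word := (seq bool).

Definition parikh (w : word) : nat * nat :=
  (count_mem false w, count_mem true w).

(* [seqlexi] is the lexicographic order in which a proper prefix of a word is
   smaller than the word. *)
Definition lexle (u v : word) : bool := ((u : seqlexi bool) <= v)%O.
Definition lexlt (u v : word) : bool := ((u : seqlexi bool) < v)%O.

(* [parikh (take i w)] is the lattice point reached after [i] steps. Since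
   half-planes are convex, a path is weakly below the segment from (0,0) to
   (a,b) as soon as its vertices (x,y) are, i.e. satisfy a y <= b x. *)
Definition below_segment (a b : nat) (w : word) : bool :=
  [forall i : 'I_(size w).+1,
    a * (parikh (take i w)).2 <= b * (parikh (take i w)).1].

(* (x,y) lies strictly above all points of the path with abscissa [x]. *)
Definition strictly_above (w : word) (x y : nat) : bool :=
  [forall i : 'I_(size w).+1,
    ((parikh (take i w)).1 == x) ==> ((parikh (take i w)).2 < y)].

(* The lattice points weakly below the segment are taken in the rectangle
   [0,a] x [0,b]; the bound y <= b only matters for the vertical segment
   a = 0, for which the condition a y <= b x is void. *)
Definition lower_christoffel (a b : nat) (w : word) : bool :=
  [&& parikh w == (a, b), below_segment a b w &
      [forall x : 'I_a.+1, forall y : 'I_b.+1,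
        (a * y <= b * x) ==> ~~ strictly_above w x y]].

Lemma lower_christoffel_from (a b n x y : nat) :
  x <= a -> y <= b -> a * y <= b * x -> n = (a - x) + (b - y) ->
  exists w : word,
    [/\ parikh w = (a - x, b - y),
        forall i, i <= size w ->
          a * (y + (parikh (take i w)).2) <= b * (x + (parikh (take i w)).1)
      & forall x' y', x <= x' <= a -> y' <= b -> a * y' <= b * x' ->
          exists i, [/\ i <= size w, x + (parikh (take i w)).1 = x'
                      & y' <= y + (parikh (take i w)).2]].
Proof.
elim: n x y => [|n IHn] x y lexa leyb lexy En.
  have [Ex Ey] : x = a /\ y = b by lia.
  subst x y; exists [::]; split.
  - by rewrite /parikh /= !subnn.
  - by move=> i _; rewrite /parikh /= !addn0.
  - move=> x' y' hx hy _; exists 0; rewrite /parikh /= !addn0.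
    by split=> //; lia.
have [/andP[ltyb up]|/nandP noup] := boolP ((y < b) && (a * y.+1 <= b * x)).
  have En' : n = (a - x) + (b - y.+1) by lia.
  have [w [Pw Bw Aw]] := IHn x y.+1 lexa ltyb up En'.
  case: Pw => P0 P1; exists (true :: w); split.
  - by rewrite /parikh /= P0 P1 add0n; congr (_, _); lia.
  - case=> [|i]; first by rewrite /parikh /= !addn0.
    by move=> /= /Bw; rewrite /parikh /= add0n add1n addnS addSn.
  - move=> x' y' hx hy h; have [i [hi hix hiy]] := Aw x' y' hx hy h.
    exists i.+1; rewrite /parikh /= ltnS hi add0n add1n.
    by split=> //; move: hiy; rewrite /parikh /= addnS addSn.
have ltxa : x < a.
  rewrite ltn_neqAle lexa andbT; apply/eqP=> Ex; subst x.
  have ltyb : y < b by lia.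
  case: noup => [|/negP]; first by rewrite ltyb.
  by apply; rewrite mulnC leq_mul2r ltyb orbT.
have right : a * y <= b * x.+1 by rewrite mulnS; lia.
have En' : n = (a - x.+1) + (b - y) by lia.
have [w [Pw Bw Aw]] := IHn x.+1 y ltxa leyb right En'.
case: Pw => P0 P1; exists (false :: w); split.
- by rewrite /parikh /= P0 P1 add0n; congr (_, _); lia.
- case=> [|i]; first by rewrite /parikh /= !addn0.
  by move=> /= /Bw; rewrite /parikh /= add0n add1n addnS addSn.
- move=> x' y' /andP[hx hxa] hy h; move: hx; rewrite leq_eqVlt => /orP[/eqP Ex|ltx].
    subst x'; exists 0; rewrite /parikh /= !addn0; split=> //.
    rewrite leqNgt; apply/negP=> lty.
    have up : a * y.+1 <= b * x by apply: leq_trans h; rewrite leq_mul2l lty orbT.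
    by case: noup => /negP; apply=> //; apply: leq_trans hy.
  have [|i [hi hix hiy]] := Aw x' y' _ hy h; first by rewrite ltx.
  exists i.+1; rewrite /parikh /= ltnS hi add0n add1n.
  by split=> //; move: hix; rewrite /parikh /= addnS addSn.
Qed.

Lemma lower_christoffel_exists (a b : nat) :
  exists w : word, lower_christoffel a b w.
Proof.
have [w [Pw Bw Aw]] :=
  @lower_christoffel_from a b ((a - 0) + (b - 0)) 0 0 (leq0n a) (leq0n b)
    (eq_leq (etrans (muln0 a) (esym (muln0 b)))) erefl.
exists w; apply/and3P; split.
- by rewrite Pw !subn0.
- by apply/forallP=> i; apply: Bw; rewrite -ltnS.
- apply/forallP=> x; apply/forallP=> y; apply/implyP=> h.
  have [||i [hi hix hiy]] := Aw x y _ _ h; first by rewrite leq0n -ltnS /=.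
    by rewrite -ltnS.
  apply/negP=> /forallP/(_ (Ordinal (hi : i < (size w).+1)))/=.
  by rewrite -{1}hix add0n eqxx /= ltnNge hiy.
Qed.

Lemma lower_christoffel_inj (a b : nat) (w w' : word) :
  lower_christoffel a b w -> lower_christoffel a b w' -> w = w'.
Proof.
have size_parikh (v : word) : size v = (parikh v).1 + (parikh v).2.
  by rewrite /parikh /=; elim: v => //= -[] v ->; rewrite ?add0n ?add1n ?addnS ?addSn.
have diverge (u v v' : word) : lower_christoffel a b (u ++ false :: v) ->
    ~~ lower_christoffel a b (u ++ true :: v').
  move=> /and3P[/eqP P _ A]; apply/negP=> /and3P[/eqP P' B' _].
  set x := (parikh u).1; set y := (parikh u).2.+1.
  have ltxa : x < a.+1 by case: P => <- _; rewrite /x /parikh /= count_cat; lia.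
  have ltyb : y < b.+1 by case: P' => _ <-; rewrite /y /parikh /= count_cat /=; lia.
  have hxy : a * y <= b * x.
    have hs : (size u).+1 < (size (u ++ true :: v')).+1 by rewrite size_cat /=; lia.
    move/forallP: B' => /(_ (Ordinal hs)) /=.
    rewrite take_cat ltnNge leqnSn /= subSnn /= take0 /parikh /= !count_cat /=.
    by rewrite !addn0 addn1.
  move/forallP: A => /(_ (Ordinal ltxa))/forallP/(_ (Ordinal ltyb)) /=.
  rewrite hxy /= => /negP; apply; apply/forallP=> i; apply/implyP=> /eqP.
  rewrite take_cat /y /x ltnS; case: ltnP => hi.
    have := count_cat (pred1 true) (take i u) (drop i u).
    by rewrite cat_take_drop /parikh /=; lia.
  case: (i - size u) => [|k]; first by rewrite take0 cats0.
  by rewrite /parikh /= count_cat /=; lia.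
move=> Cw Cw'.
have Es : size w = size w'.
  by rewrite !size_parikh; case/and3P: Cw => /eqP-> _ _; case/and3P: Cw' => /eqP-> _ _.
suff main (u v v' : word) : size v = size v' ->
    lower_christoffel a b (u ++ v) -> lower_christoffel a b (u ++ v') -> v = v'.
  exact: (main [::]).
elim: v v' u => [|c v IHv] [|c' v'] // u [Ev].
case: c c' => -[] C C'.
- by congr (_ :: _); apply: (IHv _ (rcons u true)); rewrite ?cat_rcons.
- by move: (diverge _ _ v C'); rewrite C.
- by move: (diverge _ _ v' C); rewrite C'.
- by congr (_ :: _); apply: (IHv _ (rcons u false)); rewrite ?cat_rcons.
Qed.

Definition christoffel (a b : nat) : word :=
  xchoose (lower_christoffel_exists a b).

Lemma christoffelP (a b : nat) (w : word) :
  reflect (w = christoffel a b) (lower_christoffel a b w).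
Proof.
apply: (iffP idP) => [Cw|->]; last exact: xchooseP.
exact: lower_christoffel_inj Cw (xchooseP _).
Qed.

Definition balanced (w : word) : Prop :=
  forall u v : word, infix u w -> infix v w -> size u = size v ->
    count_mem false u <= (count_mem false v).+1.

Definition primitive (w : word) : Prop :=
  w <> [::] /\
  forall (v : word) (n : nat), size v < size w -> w <> flatten (nseq n v).

Definition lyndon (w : word) : Prop :=
  primitive w /\ forall i : nat, rot i w <> w -> lexlt w (rot i w).

Definition lyndon_factorization (w : word) (s : seq word) : Prop :=
  [/\ forall l, l \in s -> lyndon l, sorted (fun u v => lexle v u) s
    & flatten s = w].

Definition digitally_convex (w : word) : Prop :=
  exists2 s : seq word,
    lyndon_factorization w s & forall l, l \in s -> balanced l.

Definition inflation (w w' : word) : Prop :=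
  [/\ digitally_convex w, digitally_convex w'
    & exists u v : word,
        w = u ++ [:: false; true] ++ v /\ w' = u ++ [:: true; false] ++ v].

Definition deflation (w w' : word) : Prop :=
  [/\ digitally_convex w, digitally_convex w'
    & exists u v : word,
        w = u ++ [:: true; false] ++ v /\ w' = u ++ [:: false; true] ++ v].

(* A finite, possibly empty, sequence of steps. *)
Definition steps (r : word -> word -> Prop) : word -> word -> Prop :=
  clos_refl_trans word r.

(* Main.v *)
Require Import Defs.
From mathcomp Require Import all_boot all_order zify.
From Stdlib Require Import Relation_Operators.

(** The lattice points on or below a digitally convex path form a convex
    set of lattice points, and the theorem is an instance of a general fact on
    such sets: if S is strictly contained in T, both convex, then some extreme
    point of T lies outside S, and removing an extreme point keeps T convex.
    Removing points one at a time thus leads from T to S.  Removing an extreme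
    point from below a path is a deflation.  The word 1^b 0^a bounds the largest
    set and the Christoffel word the smallest one, so every digitally convex
    word is reached from the former by deflations, and reaches the latter by
    deflations, which are inflations read backwards.

    A path is described by [height w i], the number of letters 1 among the first
    [i] letters; the linear map (x, y) |-> (x + y, y) turns the path into the
    graph of this function, and points below the path into points below the
    graph.  Convexity becomes [supported]: for each [i], some
    functional is strictly larger at (i, height w i + 1) than on the graph;
    equivalently, the height is the integer part of a concave function.

    The extreme point is found by maximising over the path of T a functional
    that separates from S a point of T missing in S
    ([supported_remove_corner], iterated in [deflation_descent]).

    It remains to see that [supported] is the same as digitally convex.
    A balanced Lyndon word is [mechanical]: its height is the integer part of a
    linear function ([lyndon_balanced_mechanical]).  Among mechanical words a
    steeper slope means a lexicographically larger word ([mechanical_lexlt]),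
    so in a Lyndon factorization into balanced words the slopes do not increase,
    and the line carried by a factor lies above the whole path
    ([digitally_convex_supported]).  Conversely, the shortest prefix of maximal
    slope of a supported word is mechanical, hence balanced and Lyndon, and
    cutting off such prefixes gives the Lyndon factorization
    ([supported_digitally_convex]). *)

Set Implicit Arguments.
Unset Strict Implicit.
Unset Printing Implicit Defensive.

(** * Heights *)

Definition ones (w : word) : nat := count_mem true w.

Definition height (w : word) (k : nat) : nat := ones (take k w).

Lemma ones_cat u v : ones (u ++ v) = ones u + ones v.
Proof. exact: count_cat. Qed.

Lemma zeros_ones w : count_mem false w + ones w = size w.
Proof. by rewrite /ones; elim: w => //= -[] w <-; lia. Qed.

Lemma height0 w : height w 0 = 0.
Proof. by rewrite /height take0. Qed.

Lemma height_oversize w k : size w <= k -> height w k = ones w.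
Proof. by move=> h; rewrite /height take_oversize. Qed.

Lemma heightD w i k : height w (i + k) = height w i + height (drop i w) k.
Proof. by rewrite /height takeD ones_cat. Qed.

Lemma height_catl u v k : k <= size u -> height (u ++ v) k = height u k.
Proof. by move=> h; rewrite /height takel_cat. Qed.

Lemma height_catr u v k : height (u ++ v) (size u + k) = ones u + height v k.
Proof. by rewrite heightD drop_size_cat // height_catl // height_oversize. Qed.

Lemma height_cons c w k : height (c :: w) k.+1 = c + height w k.
Proof. by rewrite /height /ones /=; case: c. Qed.

Lemma heightS w k : height w k.+1 = height w k + nth false w k.
Proof.
elim: w k => [|c w IHw] [|k]; rewrite ?height_cons ?height0 //=.
  by rewrite addn0.
by rewrite IHw addnA.
Qed.

Lemma height_step w k : height w k <= height w k.+1 <= (height w k).+1.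
Proof. by rewrite heightS; case: (nth _ _ _); lia. Qed.

Lemma height_stepD w i k : height w i <= height w (i + k) <= height w i + k.
Proof.
elim: k => [|k IHk]; first by rewrite addn0; lia.
by have := height_step w (i + k); rewrite addnS; lia.
Qed.

Lemma height_mono w i j : i <= j -> height w i <= height w j.
Proof. by move=> /subnKC <-; have := height_stepD w i (j - i); lia. Qed.

Lemma height_le w k : height w k <= k.
Proof. by have := height_stepD w 0 k; rewrite height0 add0n; lia. Qed.

Lemma height_le_ones w k : height w k <= ones w.
Proof.
have [h|h] := leqP (size w) k; first by rewrite height_oversize.
by rewrite -(height_oversize (leqnn (size w))) height_mono // ltnW.
Qed.

Lemma height_inj u v :
  size u = size v -> (forall k, k <= size u -> height u k = height v k) -> u = v.
Proof.
move=> Es h; apply: (@eq_from_nth _ false) => // i hi.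
by have := h i.+1 hi; rewrite !heightS (h i (ltnW hi)); do 2!case: (nth _ _ _); lia.
Qed.

(** * Lexicographic order *)

Lemma lexlt_cons x y (u v : word) :
  lexlt (x :: u) (y :: v) = (~~ x && y) || ((x == y) && lexlt u v).
Proof.
by rewrite /lexlt Order.SeqLexiOrder.ltxi_cons; case: x y => [] [].
Qed.

Lemma lexlt_cat2l (u v w : word) : lexlt (w ++ u) (w ++ v) = lexlt u v.
Proof. by elim: w => //= c w; rewrite lexlt_cons eqxx; case: c. Qed.

Lemma lexlt_divergence (u v : word) : size u = size v -> lexlt u v ->
  exists t u' v', u = t ++ false :: u' /\ v = t ++ true :: v'.
Proof.
elim: u v => [|x u IHu] [|y v] //= [Es].
rewrite lexlt_cons => /orP[|/andP[/eqP <- /IHu]].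
  by case: x y => [] [] // _; exists [::], u, v.
by case=> // t [u' [v' [-> ->]]]; exists (x :: t), u', v'.
Qed.

Lemma lexlt_cat2r (x y u : word) :
  size x = size y -> lexlt x y -> lexlt (x ++ u) (y ++ u).
Proof.
move=> Es /(lexlt_divergence Es) [t [x' [y' [-> ->]]]].
by rewrite -!catA lexlt_cat2l.
Qed.

(** Where two words first differ, the one that is ahead in height has the
    letter 1; if they do not differ, one is a prefix of the other. *)
Lemma lexlt_of_height (u v : word) :
  (forall k, k <= size u -> k <= size v -> height u k <= height v k) ->
  lexlt u v \/ prefix v u.
Proof.
elim: u v => [|x u IHu] [|y v] h; [by right|by left|by right|].
have := h 1 isT isT; rewrite !height_cons !height0.
case: (eqVneq x y) => [Exy|]; last first.
  by case: x y {h} => [] [] // _ _; left; rewrite lexlt_cons.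
move=> _; subst y; case: (IHu v) => [k hu hv|lt|pre].
- by have := h k.+1 hu hv; rewrite !height_cons; lia.
- by left; rewrite lexlt_cons eqxx lt orbT.
- by right; rewrite prefix_cons eqxx.
Qed.

(** * Convex paths and removal of an extreme point *)

(** The point (i, height w i + 1), the lowest one above the path on its
    antidiagonal, is separated from all vertices of the path by the functional
    (j, y) |-> M y - n j.  Separating these points is enough: the functional
    increases with y, so it also separates the higher points of the antidiagonal. *)
Definition supported (w : word) : Prop :=
  forall i, i <= size w -> exists M n, forall j, j <= size w ->
    M * height w j + n * i < M * (height w i).+1 + n * j.

Lemma supported_drop w i : supported w -> supported (drop i w).
Proof.
have [hi|hi] := leqP i (size w) => Sw; last first.
  rewrite drop_oversize ?(ltnW hi) // => k; rewrite leqn0 => /eqP->.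
  by exists 1, 0 => j; rewrite leqn0 => /eqP->; rewrite height0.
move=> k; rewrite size_drop => hk; have hik : i + k <= size w by lia.
have [M [n hMn]] := Sw _ hik; exists M, n => j hj.
have := hMn (i + j); rewrite !heightD; have -> : i + j <= size w by lia.
by move/(_ isT); nia.
Qed.

(** A lattice point weakly below a chord of the path cannot be separated from
    the ends of the chord, hence is not above the path. *)
Lemma supported_chord w i k : supported w -> k <= i <= size w -> 0 < i ->
  k * height w i < (height w k).+1 * i.
Proof.
move=> Sw /andP[hki hi] i0; have [M [n h]] := Sw k (leq_trans hki hi).
have := h 0 (leq0n _); have := h i hi; rewrite height0 !muln0 add0n addn0.
set c := (height w k).+1; set p := height w i => h1 h2.
rewrite ltnNge; apply/negP => le.
have [r Ei] : exists r, i = k + r by exists (i - k); rewrite subnKC.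
move: @p i0 h1 le; rewrite {}Ei => p i0 h1 le.
(* The two strict inequalities say that the functional is larger at (k, c) than
   at the ends 0 and k + r of the chord; weighted by r and k they contradict
   that (k, c) lies weakly below the chord. *)
have e1 : r * (n * k) <= r * (M * c) by rewrite leq_mul2l ltnW ?orbT.
have e2 : k * (M * p + n * k) <= k * (M * c + n * (k + r)).
  by rewrite leq_mul2l (ltnW h1) orbT.
have e3 : M * (c * (k + r)) <= M * (k * p) by rewrite leq_mul2l le orbT.
have [k0|k0] := posnP k.
  have e1' : r * (n * k) < r * (M * c) by rewrite ltn_pmul2l //; lia.
  by nia.
have e2' : k * (M * p + n * k) < k * (M * c + n * (k + r)) by rewrite ltn_pmul2l.
by nia.
Qed.

Lemma height_flip u v k :
  height (u ++ [:: true; false] ++ v) k =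
  height (u ++ [:: false; true] ++ v) k + (k == (size u).+1).
Proof.
have [h|h] := leqP k (size u).
  by rewrite !height_catl // ltn_eqF ?addn0 // ltnS.
rewrite -(subnKC (ltnW h)) !height_catr /=.
rewrite -[(size u).+1]addn1 eqn_add2l; move: (k - size u) (h) => m.
case: m => [|[|m]] _.
- by rewrite !height0 !addn0.
- by rewrite !height_cons !height0; lia.
- by rewrite !height_cons /=; lia.
Qed.

(** The point above [w] that is separated from [w] by a functional and lies weakly
    below [w'] shows that the maximum of the functional over [w'] is reached at a
    vertex strictly above [w].  Breaking ties in favour of the first such
    vertex is a perturbation of the functional that makes the maximum strict: the
    vertex is an extreme point of [w'].  It is preceded by 1 and followed by 0, and
    once it is removed the perturbed functional separates it from the new path. *)
Lemma supported_remove_corner w w' :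
  supported w -> supported w' -> size w = size w' -> ones w = ones w' ->
  (forall k, height w k <= height w' k) -> w <> w' ->
  exists u v, [/\ w' = u ++ [:: true; false] ++ v,
    supported (u ++ [:: false; true] ++ v)
    & forall k, height w k <= height (u ++ [:: false; true] ++ v) k].
Proof.
move=> Sw Sw' Es Eo le neq; move L_def: (size w') Es => L Es.
have [i hi lti] : exists2 i, i <= L & height w i < height w' i.
  have [/existsP[i hi]|] := boolP [exists i : 'I_L.+1, height w i < height w' i].
    by exists i => //; rewrite -ltnS.
  move/existsPn => h; case: neq; apply: height_inj => [|k hk]; first by rewrite L_def.
  have hk' : k < L.+1 by rewrite ltnS -Es.
  by have := h (Ordinal hk'); have := le k; rewrite /=; lia.
have [M [n hMn]] : exists M n, forall j, j <= L ->
    M * height w j + n * i < M * (height w i).+1 + n * j.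
  by have [|M [n h]] := Sw i; [rewrite Es|exists M, n => j; rewrite -Es; apply: h].
(* [F] is the functional, shifted by a constant to stay in [nat], and multiplied
   by a number large enough for the added term [L - j], which breaks ties, not to
   affect strict comparisons. *)
pose F (j : 'I_L.+1) := L.+1 * (M * height w' j + n * (L - j)) + (L - j).
have hi' : i < L.+1 by [].
case: (@arg_maxnP _ (Ordinal hi') xpredT F isT) => p _ maxp.
have Finj j : j != p -> F j < F p.
  move=> nj; rewrite ltn_neqAle; apply/andP; split; last exact: maxp.
  apply: contra nj => /eqP E; apply/eqP/val_inj => /=.
  have := congr1 (modn^~ L.+1) E; rewrite /F /= ![L.+1 * _]mulnC !modnMDl.
  by rewrite !modn_small; have := ltn_ord j; have := ltn_ord p; lia.
have hp : p <= L by rewrite -ltnS.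
have above : height w p < height w' p.
  rewrite ltnNge; apply/negP => lep; have := hMn p hp; have := maxp (Ordinal hi') isT.
  rewrite /F /= => Fip lt.
  have le1 : M * (height w i).+1 <= M * height w' i by rewrite leq_mul2l lti orbT.
  have le2 : M * height w' p <= M * height w p by rewrite leq_mul2l lep orbT.
  have : (M * height w' p + n * (L - p)).+1 <= M * height w' i + n * (L - i).
    by rewrite !mulnBr; have := leq_mul2l n p L; have := leq_mul2l n i L; lia.
  by move/(leq_mul (leqnn L.+1)); rewrite mulnS; lia.
have p0 : 0 < p by case: (posnP p) above => // ->; rewrite !height0.
have pL : p < L.
  rewrite ltnNge; apply/negP => h; move: above.
  by rewrite !height_oversize ?Es ?L_def // Eo ltnn.
have slope j (hj : j < L.+1) : j != p :> nat ->
    M * height w' j + n * (L - j) + (j < p) <= M * height w' p + n * (L - p).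
  move=> nj; have := Finj (Ordinal hj); rewrite -val_eqE /= => /(_ nj).
  rewrite /F /=; set A := _ + n * (L - j); set B := _ + n * (L - p) => lt.
  case: (ltnP j p) => hjp; rewrite ?addn1 ?addn0.
    by rewrite -(ltn_pmul2l (ltn0Sn L)); lia.
  by rewrite -ltnS -(ltn_pmul2l (ltn0Sn L)) mulnS; lia.
have E1 : height w' p = (height w' p.-1).+1.
  have := slope p.-1; have -> : p.-1 < L.+1 by lia.
  have -> : p.-1 != p :> nat by lia.
  have -> : p.-1 < p by lia.
  have -> : L - p.-1 = (L - p).+1 by lia.
  move=> /(_ isT isT); have := height_step w' p.-1; rewrite prednK //.
  have [-> _|] := eqVneq (height w' p) (height w' p.-1); last by lia.
  by rewrite mulnS; lia.
have E2 : height w' p.+1 = height w' p.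
  have := slope p.+1; have -> : p.+1 < L.+1 by lia.
  have -> : p.+1 != p :> nat by lia.
  have -> : L - p = (L - p.+1).+1 by lia.
  have -> : (p.+1 < p) = false by lia.
  move=> /(_ isT isT); have := height_step w' p.
  have [-> _|] := eqVneq (height w' p.+1) (height w' p).+1; last by lia.
  have := slope p.-1; have -> : p.-1 < L.+1 by lia.
  have -> : p.-1 != p :> nat by lia.
  have -> : p.-1 < p by lia.
  have -> : L - p.-1 = (L - p.+1).+2 by lia.
  have -> : L - p = (L - p.+1).+1 by lia.
  by move=> /(_ isT isT); rewrite E1 !mulnS; lia.
pose u := take p.-1 w'; pose v := drop p.+1 w'.
have su : size u = p.-1 by rewrite size_takel // L_def; lia.
have Ew' : w' = u ++ [:: true; false] ++ v.
  rewrite -[LHS](cat_take_drop p.-1) -/u; congr (_ ++ _).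
  have hp1 : p.-1 < size w' by rewrite L_def; lia.
  rewrite (drop_nth false hp1) prednK // (@drop_nth _ false p) ?L_def // /v.
  move: E1 E2; rewrite -{1}(prednK p0) !heightS.
  by do 2!case: (nth _ _ _) => //=; lia.
have Eh k : height w' k = height (u ++ [:: false; true] ++ v) k + (k == p).
  by rewrite {1}Ew' height_flip su prednK.
exists u, v; split=> //; last first.
  move=> k; have := Eh k; have := le k; case: eqP => [->|]; last by lia.
  by move: above; lia.
have sw'' : size (u ++ [:: false; true] ++ v) = L.
  by rewrite -L_def [in RHS]Ew' !size_cat.
(* Away from [p] the old separating lines still work, as the path only went
   down. *)
move=> k; rewrite sw'' => hk; have [Ek|nk] := eqVneq k p; last first.
  have [|M' [n' h]] := Sw' k; first by rewrite L_def.
  have -> : height (u ++ [:: false; true] ++ v) k = height w' k.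
    by rewrite (Eh k) (negPf nk) addn0.
  exists M', n' => j hj; apply: leq_ltn_trans (h j _); last by rewrite L_def.
  by rewrite leq_add2r leq_mul2l (Eh j) leq_addr orbT.
subst k; exists (L.+1 * M), (L.+1 * n).+1 => j hj.
have M0 : 0 < M by have := hMn i hi; case: (M); lia.
have [->|nj] := eqVneq j p.
  by rewrite ltn_add2r ltn_pmul2l // muln_gt0.
have := slope j hj nj; have := Eh j; have := Eh p; rewrite eqxx (negPf nj) addn0 addn1.
move=> -> ->; set A := (height _ p).+1; set B := height _ j => le1.
have : M * B + n * p + (j < p) <= M * A + n * j.
  rewrite !mulnBr in le1.
  by have := leq_mul2l n p L; have := leq_mul2l n j L; lia.
move/(leq_mul (leqnn L.+1)); case: ltnP => /=; nia.
Qed.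

(** * Balanced Lyndon words *)

(** The height at [k] is the integer part of [k * ones l / size l]; the strict
    inequality at [k = 0] excludes the empty word. *)
Definition mechanical (l : word) : Prop :=
  forall k, k <= size l ->
    height l k * size l <= k * ones l < (height l k).+1 * size l.

(** Cancelling the shorter word from the longer one leaves a shorter commuting
    pair, as in the Euclidean algorithm. *)
Lemma commute_powers (T : Type) (u v : seq T) : u ++ v = v ++ u ->
  exists t m n, u = flatten (nseq m t) /\ v = flatten (nseq n t).
Proof.
have [s] := ubnP (size u + size v).
elim: s u v => // s IHs u v hs Euv.
wlog leuv : u v hs Euv / size u <= size v => [H|].
  have [h|h] := leqP (size u) (size v); first exact: H.
  case: (H v u) => [|//||t [m [n [Ev Eu]]]]; [by rewrite addnC|exact: ltnW|].
  by exists t, n, m.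
have [/size0nil u0|u_gt0] := posnP (size u).
  by exists v, 0, 1; rewrite u0 /= cats0.
have Ev : v = u ++ drop (size u) v.
  rewrite -{1}(cat_take_drop (size u) v); congr (_ ++ _).
  by have := congr1 (take (size u)) Euv; rewrite take_size_cat // takel_cat.
case: (IHs u (drop (size u) v)) => [||t [m [n [Eu Ed]]]].
- by rewrite size_drop; lia.
- have := congr1 (drop (size u)) Euv.
  by rewrite {2 3}Ev -catA !drop_size_cat // => <-.
- exists t, m, (m + n); split=> //.
  by rewrite nseqD flatten_cat -Eu -Ed -Ev.
Qed.

Lemma primitive_rot w i : primitive w -> 0 < i < size w -> rot i w <> w.
Proof.
move=> [_ prim] /andP[i0 iw] Er.
have E : take i w ++ drop i w = drop i w ++ take i w.
  by rewrite cat_take_drop -{1}Er.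
have [t [m [n [Et Ed]]]] := commute_powers E.
have sz k : size (flatten (nseq k t)) = k * size t.
  by elim: k => //= k IHk; rewrite size_cat IHk mulSn.
have st : size (take i w) = i by rewrite size_takel // ltnW.
have sd := size_drop i w.
rewrite Et sz in st; rewrite Ed sz in sd.
apply: (prim t (m + n)); last by rewrite nseqD flatten_cat -Et -Ed cat_take_drop.
by apply: leq_ltn_trans iw; rewrite -st leq_pmull //; case: (m) st i0 => // <-.
Qed.

(** The suffix of a Lyndon word starting at [i] differs from the prefix of the same
    length, and is larger.  The difference occurs before the suffix ends because
    a Lyndon word has no border: if w = u x = y u with u nonempty and proper,
    comparing w with its conjugates u y and x u gives x < y and y < x. *)
Lemma lyndon_divergence w i : lyndon w -> 0 < i < size w ->
  exists d, [/\ d < size w - i,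
    forall j, j <= d -> height w (i + j) = height w i + height w j,
    height w d.+1 = height w d
    & height w (i + d.+1) = height w i + (height w d).+1].
Proof.
move=> [prim lyn] /andP[i0 iw].
have rotlt k : 0 < k < size w -> lexlt w (rot k w).
  by move=> hk; apply/lyn/primitive_rot.
have lt := rotlt i; rewrite i0 iw in lt.
have [t [u' [v' [Ew Er]]]] := lexlt_divergence (esym (size_rot i w)) (lt isT).
have [hd|hd] := ltnP (size t) (size w - i).
  have hrot j : j <= size w - i -> height w (i + j) = height w i + height (rot i w) j.
    by move=> hj; rewrite heightD /rot height_catl // size_drop.
  exists (size t); split=> //.
  - move=> j hj; rewrite hrot; last by lia.
    by congr (_ + _); rewrite Er [in RHS]Ew !height_catl.
  - rewrite -(addn1 (size t)) Ew height_catr height_cons height0 height_catl //.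
    by rewrite height_oversize ?addn0.
  - rewrite hrot //; congr (_ + _).
    rewrite -(addn1 (size t)) Er [in RHS]Ew height_catr height_cons height0.
    by rewrite height_catl // height_oversize // addn0 addn1.
set u := drop i w; have su : size u = size w - i by rewrite size_drop.
pose y := take i w; pose x := drop (size w - i) w.
have Ewy : w = y ++ u by rewrite cat_take_drop.
have Ewx : w = u ++ x.
  rewrite -[LHS](cat_take_drop (size w - i)); congr (_ ++ _).
  transitivity (take (size w - i) (rot i w)); last by rewrite /rot take_size_cat.
  by rewrite Er {2}Ew !takel_cat.
have sxy : size x = size y.
  by rewrite size_drop size_takel ?(ltnW iw) // subKn // ltnW.
have ltxy : lexlt x y.
  by rewrite -(lexlt_cat2l _ _ u) -Ewx; apply: lt.
have := rotlt (size w - i); rewrite subn_gt0 iw.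
have -> : size w - i < size w by lia.
have -> : rot (size w - i) w = x ++ u.
  by rewrite /rot -/x -su [in take _ _]Ewx take_size_cat.
move=> /(_ isT); rewrite Ewy => lt1; have lt2 := lexlt_cat2r u sxy ltxy.
by have := Order.POrderTheory.lt_trans lt1 lt2; rewrite Order.POrderTheory.ltxx.
Qed.

Lemma balanced_height w i j k : balanced w ->
  i + k <= size w -> j + k <= size w ->
  height w (i + k) + height w j <= (height w (j + k) + height w i).+1.
Proof.
move=> bal hi hj; rewrite !heightD.
have fac m : infix (take k (drop m w)) w.
  apply/infixP; exists (take m w), (drop k (drop m w)).
  by rewrite !cat_take_drop.
have sz m : m + k <= size w -> size (take k (drop m w)) = k.
  by move=> hm; rewrite size_takel // size_drop; lia.
have := bal _ _ (fac j) (fac i); rewrite (sz i) // (sz j) // => /(_ erefl).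
have := zeros_ones (take k (drop i w)); have := zeros_ones (take k (drop j w)).
by rewrite (sz i) // (sz j) // /height; lia.
Qed.

(** Compare factors of length [k] with the prefix of length [k], in height.  Where
    they first differ the prefix has 0 and the factor 1, and balance bounds the
    loss afterwards by 1: so every factor has at least as many 1s, and at most one
    more ([lower], [balh]).  For a proper suffix there is exactly one more
    ([suffixes]).  Taking complements, the same bounds hold for the factors of the
    conjugates, so the height extended to the periodic word is additive up to an
    error in {0, 1}.  Adding up [size w] steps of length [k], which go
    round the word [k] times, yields the integer part. *)
Lemma lyndon_balanced_mechanical w : lyndon w -> balanced w -> mechanical w.
Proof.
move=> lyn bal.
have N0 : 0 < size w by case: lyn => -[+ _] _; case: (w).
set N := size w in N0 *; set h := height w; set p := ones w.
have hN : h N = p by rewrite /h height_oversize.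
have balh i j k : i + k <= N -> j + k <= N -> h (i + k) + h j <= (h (j + k) + h i).+1.
  exact: balanced_height.
have h0 : h 0 = 0 by apply: height0.
have lower i k : i + k <= N -> h i + h k <= h (i + k).
  move=> hik; have [->|i0] := posnP i; first by rewrite h0.
  have [iN|iN] := ltnP i N; last first.
    have -> : k = 0 by lia.
    by rewrite h0 !addn0.
  have [|d [hd Ej E1 E2]] := @lyndon_divergence w i lyn; first by rewrite i0.
  have [hk|hk] := leqP k d; first by rewrite /h Ej.
  have := balh d.+1 (i + d.+1) (k - d.+1).
  have -> : d.+1 + (k - d.+1) = k by lia.
  have -> : i + d.+1 + (k - d.+1) = i + k by lia.
  move=> /(_ _ _); rewrite hik /h E1 E2 => /(_ _ isT).
  have -> : k <= N by lia.
  by move=> /(_ isT); lia.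
have suffixes k : 0 < k < N -> p = (h (N - k) + h k).+1.
  have [n] := ubnP k; elim: n k => // n IHn k hn /andP[k0 kN].
  have := balh (N - k) 0 k; rewrite subnK ?(ltnW kN) // add0n h0 addn0 hN leqnn.
  move=> /(_ isT isT) up.
  have [|d [hd Ej E1 E2]] := @lyndon_divergence w (N - k) lyn.
    by rewrite -/N; lia.
  have dk : d < k by move: hd; rewrite -/N; lia.
  rewrite -/h in Ej E1 E2.
  have [Ek|nk] := eqVneq k d.+1.
    by move: E2; rewrite -Ek subnK ?(ltnW kN) // hN => ->; rewrite {3}Ek E1; lia.
  have := IHn (k - d.+1).
  have -> : N - (k - d.+1) = N - k + d.+1 by lia.
  rewrite E2; have -> : k - d.+1 < n by lia.
  have -> : 0 < k - d.+1 < N by lia.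
  move=> /(_ isT isT) Ep; have := balh d.+1 0 (k - d.+1).
  rewrite subnKC // add0n h0 addn0 (ltnW kN) E1.
  have -> : k - d.+1 <= N by lia.
  by move=> /(_ isT isT); lia.
move=> k; rewrite -/N -/h -/p leq_eqVlt => /orP[/eqP->|kN].
  by rewrite hN [N * p]mulnC leqnn ltn_pmul2r /=.
have [->|k0] := posnP k; first by rewrite h0 mul0n mul1n.
(* [H] is the height of the periodic word with period [w]. *)
pose H m := (m %/ N) * p + h (m %% N).
have HS m : H m + h k <= H (m + k) <= (H m + h k).+1.
  rewrite /H; move: (divn_eq m N) (ltn_pmod m N0).
  move: (m %/ N) (m %% N) => a r -> rN.
  rewrite -![a * N + r + k]addnA divnMDl // modnMDl mulnDl.
  have [lt|ge] := ltnP (r + k) N.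
    rewrite divn_small // modn_small // mul0n addn0.
    by have := lower r k (ltnW lt); have := balh r 0 k (ltnW lt); rewrite add0n h0; lia.
  have [q Eq qr] : exists2 q, r + k = N + q & q <= r by exists (r + k - N); lia.
  have qN : q < N by lia.
  rewrite Eq divnDl ?dvdnn // divnn N0 divn_small // modnDl modn_small //.
  have := suffixes k; rewrite k0 kN => /(_ isT).
  have := lower q (N - k); have := balh q 0 (N - k).
  have -> : q + (N - k) = r by lia.
  rewrite add0n h0; have -> : N - k <= N by lia.
  by rewrite (ltnW rN) => /(_ isT isT) b1 /(_ isT); lia.
have iter m : m.+1 * h k <= H (m.+1 * k) <= m.+1 * h k + m.
  elim: m => [|m IHm]; last first.
    have := HS (m.+1 * k); rewrite [m.+2 * k]mulSnr [m.+2 * h k]mulSnr; lia.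
  by rewrite !mul1n addn0 /H divn_small // modn_small // leqnn.
have := iter N.-1; rewrite prednK // /H mulKn // modnMr h0 addn0.
by have := ltn_predL N; rewrite N0; nia.
Qed.

(** * From digitally convex words to convex paths *)

Lemma mechanical_size l : mechanical l -> 0 < size l.
Proof. by move=> /(_ 0 (leq0n _)); rewrite height0; case: (size l) => //; lia. Qed.

(** The smaller slope has the smaller integer parts, so [lexlt_of_height] applies;
    the steeper word cannot be a prefix of the other, since a prefix of a
    mechanical word has at most the slope of the word. *)
Lemma mechanical_lexlt u v : mechanical u -> mechanical v ->
  ones u * size v < ones v * size u -> lexlt u v.
Proof.
move=> Mu Mv lt; have u0 := mechanical_size Mu; have v0 := mechanical_size Mv.
have [|//|/prefixP[w Eu]] := @lexlt_of_height u v; last first.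
  have := Mu (size v); rewrite {1 2}Eu size_cat leq_addr => /(_ isT).
  by rewrite height_catl // height_oversize //; lia.
move=> k hu hv; have /andP[a _] := Mu k hu; have /andP[_ b] := Mv k hv.
have e1 := leq_mul a (leqnn (size v)); have e2 := leq_mul (leqnn k) (ltnW lt).
have e3 : k * ones v * size u < (height v k).+1 * size v * size u by rewrite ltn_pmul2r.
have : height u k * (size u * size v) < (height v k).+1 * (size u * size v) by lia.
by rewrite ltn_pmul2r ?muln_gt0 ?u0.
Qed.

Lemma mechanical_slope_le u v : mechanical u -> mechanical v ->
  lexle u v -> ones u * size v <= ones v * size u.
Proof.
move=> Mu Mv le; rewrite leqNgt; apply/negP => /(mechanical_lexlt Mv Mu) lt.
by have := Order.POrderTheory.le_lt_trans le lt; rewrite Order.POrderTheory.ltxx.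
Qed.

Lemma flatten_height_le p N (s : seq word) :
  (forall l : word, l \in s -> mechanical l) ->
  (forall l : word, l \in s -> ones l * N <= p * size l) ->
  forall j, j <= size (flatten s) -> height (flatten s) j * N <= p * j.
Proof.
elim: s => [|l s IHs] Ms le j /=; first by rewrite leqn0 => /eqP->; rewrite height0.
have Ml : mechanical l by apply/Ms/mem_head.
have l0 := mechanical_size Ml; have lel := le l (mem_head l s).
have [h|h] := leqP j (size l) => hj.
  rewrite height_catl // -(leq_pmul2r l0).
  have /andP[a _] := Ml j h; have := leq_mul a (leqnn N).
  by have := leq_mul (leqnn j) lel; lia.
rewrite -(subnKC (ltnW h)) height_catr mulnDl mulnDr leq_add //.
apply: IHs => [l' hl'|l' hl'|].
- by apply: Ms; rewrite inE hl' orbT.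
- by apply: le; rewrite inE hl' orbT.
- by rewrite leq_subLR -size_cat.
Qed.

(** The line supporting position [i] is carried by the factor that contains [i]: it
    lies above the path on this factor, above the later factors, which are
    not steeper, and above the earlier ones, which are at least as steep.  The bound [p / N] on
    the slope of the line is what allows the induction to put a steeper factor in
    front. *)
Lemma flatten_supported p N (s : seq word) :
  (forall l : word, l \in s -> mechanical l) ->
  sorted (fun u v => lexle v u) s ->
  (forall l : word, l \in s -> ones l * N <= p * size l) ->
  forall i, i <= size (flatten s) -> exists M n, n * N <= p * M /\
    forall j, j <= size (flatten s) ->
      M * height (flatten s) j + n * i < M * (height (flatten s) i).+1 + n * j.
Proof.
elim: s p N => [|l s IHs] p N Ms /= Ss le i hi.
  exists 1, 0; split=> // j; move: hi; rewrite !leqn0 => /eqP-> /eqP->.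
have Ml : mechanical l by apply/Ms/mem_head.
have Ms' l' : l' \in s -> mechanical l' by move=> h; apply: Ms; rewrite inE h orbT.
have l0 := mechanical_size Ml; have lel := le l (mem_head l s).
have les l' : l' \in s -> ones l' * size l <= ones l * size l'.
  move=> hl'; apply: mechanical_slope_le => //; first exact: Ms'.
  have tr : transitive (fun u v : word => lexle v u).
    by move=> x y z h1 h2; apply: Order.POrderTheory.le_trans h2 h1.
  by move/(order_path_min tr)/allP: Ss; apply.
have [h|h] := leqP i (size l).
  exists (size l), (ones l); split=> // j hj.
  have := @flatten_height_le (ones l) (size l) (l :: s) Ms _ j hj.
  have /andP[_ b] := Ml i h; rewrite [height _ i]height_catl //=.
  have H l' : l' \in l :: s -> ones l' * size l <= ones l * size l'.
    by rewrite inE => /predU1P[->|/les].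
  by move/(_ H); lia.
have [|M [n [leMn IH]]] := IHs (ones l) (size l) Ms' (path_sorted Ss) les (i - size l).
  by rewrite leq_subLR -size_cat.
exists M, n; split.
  rewrite -(leq_pmul2r l0); have := leq_mul leMn (leqnn N).
  by have := leq_mul lel (leqnn M); lia.
move=> j hj; rewrite -{1 2}(subnKC (ltnW h)) height_catr.
have [hjl|hjl] := leqP j (size l).
  have := IH 0 (leq0n _); rewrite height0 [height _ j]height_catl //.
  have /andP[a _] := Ml j hjl; set A := height l j in a *; move=> lt.
  suff : M * A + n * size l <= M * ones l + n * j by lia.
  have := leq_mul (leqnn M) a; have [r Er] : exists r, size l = j + r.
    by exists (size l - j); rewrite subnKC.
  have := leq_mul leMn (leqnn r) => e1 e2; rewrite -(leq_pmul2r l0).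
  by rewrite Er in e1 e2 *; lia.
rewrite -(subnKC (ltnW hjl)) height_catr.
by have := IH (j - size l); move: hj; rewrite size_cat leq_subLR => -> /(_ isT); lia.
Qed.

Lemma digitally_convex_supported w : digitally_convex w -> supported w.
Proof.
case=> s [Ls Ss <-] Bs i hi.
have Ms l : l \in s -> mechanical l.
  by move=> hl; apply: lyndon_balanced_mechanical; [apply: Ls|apply: Bs].
(* The bound 1 / 0 on the slopes is void. *)
have le (l : word) : l \in s -> ones l * 0 <= 1 * size l by rewrite muln0.
by have [M [n [_ h]]] := flatten_supported Ms Ss le hi; exists M, n.
Qed.

(** * From convex paths to digitally convex words *)

(** Together with [mechanical], this says that the size of [l] and its number of 1s
    are coprime: no proper prefix has the slope of [l]. *)
Definition irreducible (l : word) : Prop :=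
  forall k, 0 < k < size l -> height l k * size l <> k * ones l.

(** The number of 1s in a factor differs by less than 1 from its size times the
    slope, so those of two factors of the same size differ by less than 2. *)
Lemma mechanical_balanced l : mechanical l -> balanced l.
Proof.
move=> Ml u v /infixP[u1 [u2 Eu]] /infixP[v1 [v2 Ev]] Es.
have N0 := mechanical_size Ml.
have H x y z : l = x ++ y ++ z ->
    [/\ height l (size x) + ones y = height l (size x + size y),
     size x <= size l & size x + size y <= size l].
  move=> El; split; last 2 first.
  - by rewrite El size_cat leq_addr.
  - by rewrite El !size_cat addnA leq_addr.
  rewrite heightD El drop_size_cat // [height (y ++ z) _]height_catl //.
  by rewrite [height y _]height_oversize.
have [e1 h1 h2] := H _ _ _ Eu; have [e3 h3 h4] := H _ _ _ Ev.
have := zeros_ones u; have := zeros_ones v; rewrite Es.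
have := Ml _ h1; have := Ml _ h2; have := Ml _ h3; have := Ml _ h4.
rewrite -e1 -e3 Es; move: (height l _) (height l _) => A B.
move: N0; set N := size l; set p := ones l; set k := size v.
set x := size u1; set y := size v1;
move=> N0 /andP[a1 a2] /andP[a3 a4] /andP[a5 a6] /andP[a7 a8] z1 z2.
suff : ones v <= (ones u).+1 by lia.
rewrite -ltnS -(ltn_pmul2r N0); lia.
Qed.

(** A prefix of length [k] of a conjugate has floor((i + k) s) - floor(i s) letters
    1, where s is the slope, which is at least floor(k s).  A proper power has a
    proper prefix with the same slope, which irreducibility excludes. *)
Lemma mechanical_irreducible_lyndon l : mechanical l -> irreducible l -> lyndon l.
Proof.
move=> Ml Il; have N0 := mechanical_size Ml; split; first split.
- by move=> El; rewrite El in N0.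
- move=> t n ht El.
  have [sz on] : size l = n * size t /\ ones l = n * ones t.
    by rewrite El; elim: (n) => //= m [E1 E2]; rewrite size_cat ones_cat E1 E2 !mulSn.
  have n0 : 0 < n by case: (n) sz N0 => // ->.
  have t0 : 0 < size t by move: N0; rewrite sz muln_gt0 => /andP[].
  apply: (Il (size t)); first by rewrite t0.
  have -> : height l (size t) = ones t.
    by rewrite El -(prednK n0) /= height_catl // height_oversize.
  by rewrite sz on; lia.
move=> i neq; have [hi|hi] := leqP (size l) i; first by case: neq; rewrite rot_oversize.
have [k hk _|//|] := @lexlt_of_height l (rot i l); last first.
  move=> /prefixP[[|x s] E]; first by case: neq; rewrite {2}E cats0.
  by move: (congr1 size E); rewrite size_cat size_rot /=; lia.
have Ei : forall j, j <= size l - i ->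
    height l i + height (rot i l) j = height l (i + j).
  by move=> j hj; rewrite heightD /rot height_catl // size_drop.
have /andP[a1 a2] := Ml i (ltnW hi); have /andP[a3 a4] := Ml k hk.
have [h|h] := leqP k (size l - i).
  have /andP[b1 b2] : height l (i + k) * size l <= (i + k) * ones l
      < (height l (i + k)).+1 * size l.
    by apply: Ml; lia.
  rewrite -(leq_add2l (height l i)) Ei // -ltnS -(ltn_pmul2r N0); lia.
have [q Ek] : exists q, k = size l - i + q.
  by exists (k - (size l - i)); rewrite subnKC // ltnW.
have Eq : height (rot i l) k + height l i = ones l + height l q.
  rewrite Ek -(size_drop i l) /rot height_catr.
  have := ones_cat (take i l) (drop i l); rewrite cat_take_drop => ->.
  rewrite {3}/height /height take_takel; first by lia.
  by lia.
have /andP[b1 b2] : height l q * size l <= q * ones l < (height l q).+1 * size l.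
  by apply: Ml; lia.
rewrite -(leq_add2r (height l i)) Eq -ltnS -(ltn_pmul2r N0).
have : k * ones l + i * ones l = size l * ones l + q * ones l.
  by rewrite -!mulnDl Ek; congr (_ * _); lia.
lia.
Qed.

(** If the slopes agree and [u] is shorter, the prefix of [v] of the size of [u] has
    the slope of [v], against irreducibility; so the sizes agree, and the slope
    determines the heights. *)
Lemma mechanical_irreducible_inj u v : mechanical u -> mechanical v ->
  irreducible u -> irreducible v -> ones u * size v = ones v * size u -> u = v.
Proof.
wlog le : u v / size u <= size v => [H|] Mu Mv Iu Iv E.
  have [h|h] := leqP (size u) (size v); first exact: H.
  by symmetry; apply: H; rewrite // ltnW.
have u0 := mechanical_size Mu; have v0 := mechanical_size Mv.
have [lt|ge] := ltnP (size u) (size v).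
  case: (Iv (size u)); first by rewrite u0.
  have /andP[a b] := Mv _ le; move: a b.
  rewrite [size u * _]mulnC -E leq_pmul2r // ltn_pmul2r //.
  by move=> a b; congr (_ * _); lia.
have Es : size u = size v by lia.
have Eo : ones u = ones v by apply/eqP; rewrite -(eqn_pmul2r v0) E Es.
apply: height_inj => // k hk; have := Mu k hk; rewrite Es Eo.
rewrite Es in hk => /andP[a b]; have /andP[c d] := Mv k hk.
have := leq_ltn_trans a d; have := leq_ltn_trans c b; rewrite !ltn_pmul2r //; lia.
Qed.

(** Take the shortest prefix among those of maximal slope.  Maximality puts the
    path below the line, [supported_chord] leaves it less than one unit below, and a
    proper prefix of the same slope would be shorter. *)
Lemma supported_steepest_prefix w : supported w -> 0 < size w ->
  exists l v, [/\ w = l ++ v, mechanical l, irreducible l &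
    forall j, j <= size w -> height w j * size l <= ones l * j].
Proof.
move=> Sw w0.
pose P k := [&& 0 < k, k <= size w &
  [forall j : 'I_(size w).+1, height w j * k <= height w k * j]].
have PP k : P k -> forall j, j <= size w -> height w j * k <= height w k * j.
  by case/and3P => _ _ /forallP h j hj; apply: (h (Ordinal (hj : j < (size w).+1))).
have exP : exists k, P k.
  have [m Em] : exists m, size w = m.+1 by exists (size w).-1; rewrite prednK.
  suff [k [k0 km h]] : exists k, [/\ 0 < k, k <= m.+1
      & forall j, j <= m.+1 -> height w j * k <= height w k * j].
    exists k; rewrite /P k0 Em km; apply/forallP => j.
    by apply: h; have := ltn_ord j; rewrite ltnS.
  elim: m {Em} => [|m [k [k0 km h]]].
    by exists 1; split=> // -[|[|j]] //; rewrite height0.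
  have [le|lt] := leqP (height w m.+2 * k) (height w k * m.+2).
    exists k; split=> // [|j]; first by lia.
    by rewrite leq_eqVlt => /orP[/eqP->|/h].
  exists m.+2; split=> // j; rewrite leq_eqVlt => /orP[/eqP->//|hj].
  rewrite -(leq_pmul2r k0); have := leq_mul (h j hj) (leqnn m.+2).
  by have := leq_mul (ltnW lt) (leqnn j); lia.
have [k Pk mink] := ex_minnP exP.
have /and3P[k0 kw _] := Pk; have hk := PP k Pk.
have sl : size (take k w) = k by rewrite size_takel.
have ol : ones (take k w) = height w k by [].
have hl j : j <= k -> height (take k w) j = height w j.
  by move=> hj; rewrite /height take_takel.
exists (take k w), (drop k w); rewrite cat_take_drop; split=> //.
- move=> j; rewrite sl ol => hj; rewrite hl // [j * _]mulnC hk ?(leq_trans hj) //=.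
  by rewrite mulnC supported_chord // hj.
- move=> j; rewrite sl ol => /andP[j0 jk]; rewrite hl ?(ltnW jk) // => E.
  suff /mink : P j by lia.
  rewrite /P j0 (leq_trans (ltnW jk) kw); apply/forallP => i.
  have hi : i <= size w by rewrite -ltnS.
  rewrite -(leq_pmul2r k0); have := congr1 (muln i) E.
  by have := leq_mul (hk i hi) (leqnn j); lia.
- by move=> j hj; rewrite sl ol hk.
Qed.

(** Successive steepest prefixes have nonincreasing slopes, since the second one
    glued to the first is still a prefix of the word.  Equal slopes give equal
    words, so that the prefixes are lexicographically nonincreasing. *)
Lemma supported_digitally_convex w : supported w -> digitally_convex w.
Proof.
move=> Sw.
suff [s [Es Ms Ss]] : exists s, [/\ flatten s = w,
    forall l : word, l \in s -> mechanical l /\ irreducible l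
    & sorted (fun u v => lexle v u) s].
  exists s => [|l /Ms[Ml _]]; last exact: mechanical_balanced.
  by split=> // l /Ms[Ml Il]; apply: mechanical_irreducible_lyndon.
have [n] := ubnP (size w); elim: n w Sw => // n IHn w Sw hn.
have [/size0nil->|w0] := posnP (size w); first by exists [::].
have [l [v [Ew Ml Il hl]]] := supported_steepest_prefix Sw w0.
have l0 := mechanical_size Ml.
have Sv : supported v.
  by have := @supported_drop w (size l) Sw; rewrite Ew drop_size_cat.
case: (IHn v Sv) => [|s [Es Ms Ss]].
  by move: hn; rewrite Ew size_cat; lia.
exists (l :: s); split.
- by rewrite /= Es.
- by move=> l'; rewrite inE => /predU1P[->|/Ms].
case: s Es Ms Ss => //= l' s Es Ms ->; rewrite andbT.
have [Ml' Il'] := Ms l' (mem_head _ _).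
have : ones l' * size l <= ones l * size l'.
  have := hl (size l + size l'); rewrite Ew height_catr -Es height_catl //.
  rewrite [height l' _]height_oversize // !size_cat.
  have -> : size l + size l' <= size l + (size l' + size (flatten s)) by lia.
  by move/(_ isT); lia.
rewrite leq_eqVlt => /orP[/eqP E|lt].
  by rewrite (mechanical_irreducible_inj Ml' Ml) // /lexle Order.POrderTheory.lexx.
by apply: Order.POrderTheory.ltW; apply: mechanical_lexlt.
Qed.

(** * The lowest and the highest path *)

Lemma parikhE a b w : parikh w = (a, b) -> size w = a + b /\ ones w = b.
Proof. by case=> <- <-; rewrite -zeros_ones. Qed.

Lemma parikh_take w k : k <= size w ->
  (parikh (take k w)).1 + height w k = k /\ (parikh (take k w)).2 = height w k.
Proof. by move=> hk; split=> //; rewrite [LHS]zeros_ones size_takel. Qed.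

(** The upper bound on the height is the condition to stay below the segment.  For
    the lower one, if (k, h + 1) were weakly below the segment, the corresponding
    lattice point, with abscissa k - h - 1, would have to be weakly below the
    path; but the path has passed this abscissa before step [k], at height at
    most [h]. *)
Lemma christoffel_floor a b k : 0 < a + b -> k <= a + b ->
  height (christoffel a b) k * (a + b) <= k * b
    < (height (christoffel a b) k).+1 * (a + b).
Proof.
move=> ab0 hk; have /christoffelP := erefl (christoffel a b).
set w := christoffel a b => /and3P[/eqP P /forallP B /forallP A].
set h := height w k.
have [sw ow] := parikhE P; have hk' : k < (size w).+1 by rewrite sw.
have [x1 y1] := parikh_take (hk' : k <= size w).
have lo : a * h <= b * (parikh (take k w)).1.
  by rewrite /h -y1; apply: B (Ordinal hk').
have hkh : (parikh (take k w)).1 = k - h by rewrite -[in RHS]x1 addnK.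
apply/andP; split.
  have := height_le w k; rewrite -/h => hle; move: lo; rewrite hkh mulnBr.
  have := leq_mul (leqnn b) hle; lia.
rewrite ltnNge; apply/negP => up.
have hbk : h < b.
  by rewrite -(ltn_pmul2r ab0); have := leq_mul hk (leqnn b); lia.
have hk1 : h < k.
  have := leq_mul (leqnn k) (leq_addl a b); rewrite -(ltn_pmul2r ab0); lia.
have hxa : k - h.+1 < a.+1.
  have := height_stepD w k (a + b - k); rewrite subnKC //.
  have : (parikh (take k w)).1 <= a.
    case: P => <- _; rewrite /parikh /= -{2}(cat_take_drop k w) count_cat leq_addr //.
  by rewrite hkh; lia.
have /forallP/(_ (Ordinal (hbk : h.+1 < b.+1)))/= := A (Ordinal hxa).
have -> : a * h.+1 <= b * (k - h.+1).
  by rewrite mulnBr; have := leq_mul (leqnn b) hk1; lia.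
move=> /= /negP; apply; apply/forallP => i; apply/implyP => /eqP Ex.
have hi : i <= size w by rewrite -ltnS.
have [x2 y2] := parikh_take hi; rewrite y2 ltnS.
have [le|lt] := leqP i k; first exact: height_mono.
have := height_stepD w k (i - k); rewrite subnKC ?(ltnW lt) // -/h.
by move: x2; rewrite Ex; lia.
Qed.

Lemma size_christoffel a b : size (christoffel a b) = a + b.
Proof.
have /christoffelP/and3P[/eqP P _ _] := erefl (christoffel a b).
by have [] := parikhE P.
Qed.

Lemma ones_christoffel a b : ones (christoffel a b) = b.
Proof.
have /christoffelP/and3P[/eqP P _ _] := erefl (christoffel a b).
by have [] := parikhE P.
Qed.

Lemma supported_christoffel a b : 0 < a + b -> supported (christoffel a b).
Proof.
move=> ab0 i; rewrite size_christoffel => hi; exists (a + b), b => j hj.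
have /andP[_ h1] := christoffel_floor ab0 hi.
by have /andP[h2 _] := christoffel_floor ab0 hj; lia.
Qed.

(** The vertices of the Christoffel path are weakly below the segment from (0, 0) to
    (a, b), which is a chord of the path of [w]. *)
Lemma christoffel_below a b w : 0 < a + b -> supported w ->
  parikh w = (a, b) -> forall k, height (christoffel a b) k <= height w k.
Proof.
move=> ab0 Sw /parikhE[sw ow] k; have [hk|hk] := leqP (a + b) k.
  by rewrite !height_oversize ?sw ?size_christoffel // ones_christoffel ow.
have /andP[lo _] := christoffel_floor ab0 (ltnW hk).
have := @supported_chord w (a + b) k Sw; rewrite sw leqnn (ltnW hk) ab0.
move=> /(_ isT isT); rewrite height_oversize ?sw // ow => up.
by rewrite -ltnS -(ltn_pmul2r ab0); lia.
Qed.

Lemma height_top a b k : height (nseq b true ++ nseq a false) k = minn k b.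
Proof.
have ho c n : ones (nseq n c) = c * n.
  by rewrite /ones count_nseq; case: c.
have hn c n m : height (nseq n c) m = c * minn m n.
  elim: n m => [|n IHn] [|m]; rewrite ?height0 ?minn0 ?min0n ?muln0 //.
  by rewrite height_cons IHn minnSS mulnS.
have [h|h] := leqP k b; first by rewrite height_catl ?size_nseq // hn mul1n; lia.
have := height_catr (nseq b true) (nseq a false) (k - b).
by rewrite size_nseq subnKC ?(ltnW h) // => ->; rewrite ho hn; lia.
Qed.

Lemma supported_top a b : supported (nseq b true ++ nseq a false).
Proof.
move=> i _; have [h|h] := leqP i b.
  by exists 1, 1 => j _; rewrite !height_top; lia.
by exists 1, 0 => j _; rewrite !height_top; lia.
Qed.

Lemma top_above w k :
  height w k <= height (nseq (ones w) true ++ nseq (count_mem false w) false) k.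
Proof. by rewrite height_top leq_min height_le height_le_ones. Qed.

(** * Descent by deflations *)

(** Each removed corner lowers the height at one place, so the sum of the heights
    decreases. *)
Lemma deflation_descent w w' :
  supported w -> supported w' -> size w = size w' -> ones w = ones w' ->
  (forall k, height w k <= height w' k) -> steps deflation w' w.
Proof.
move=> Sw; have [n] := ubnP (\sum_(k < (size w).+1) height w' k).
elim: n w' => // n IHn w' hn Sw' Es Eo le.
have [->|/eqP neq] := eqVneq w w'; first exact: rt_refl.
have [u [v [Ew' S'' le'']]] := supported_remove_corner Sw Sw' Es Eo le neq.
set w'' := u ++ _ in S'' le''.
have Eh k : height w' k = height w'' k + (k == (size u).+1).
  by rewrite Ew' height_flip.
have s'' : size w'' = size w' by rewrite Ew' !size_cat.
apply: (@rt_trans _ _ _ w'').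
  apply: rt_step; split; try exact: supported_digitally_convex.
  by exists u, v.
apply: IHn => //; first last.
- by rewrite Eo Ew' !ones_cat.
- by rewrite s''.
have hu : (size u).+1 < (size w).+1 by rewrite Es Ew' size_cat /=; lia.
apply: leq_trans (ltnSE hn); rewrite (bigD1 (Ordinal hu)) //=.
rewrite [leqRHS](bigD1 (Ordinal hu)) //= Eh eqxx addn1 ltnS leq_add2l.
by apply: leq_sum => k _; rewrite (Eh k) leq_addr.
Qed.

Lemma steps_inflation_of_deflation w w' :
  steps deflation w' w -> steps inflation w w'.
Proof.
elim=> [x y [Dx Dy [u [v [Ex Ey]]]]|x|x y z _ h1 _ h2].
- by apply: rt_step; split=> //; exists u, v.
- exact: rt_refl.
- exact: rt_trans h2 h1.
Qed.

Theorem theorem51 (a b : nat) (hab : (a, b) <> (0, 0)) :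
  (forall w : word, digitally_convex w -> parikh w = (a, b) ->
     steps inflation (christoffel a b) w) /\
  (forall w : word, digitally_convex w -> parikh w = (a, b) ->
     steps deflation (nseq b true ++ nseq a false) w).
Proof.
have ab0 : 0 < a + b by case: a b hab => [|a] [|b].
split=> w /digitally_convex_supported Sw P; have [sw ow] := parikhE P.
- apply/steps_inflation_of_deflation/deflation_descent => //.
  + exact: supported_christoffel.
  + by rewrite size_christoffel.
  + by rewrite ones_christoffel.
  + exact: christoffel_below.
- have Ea : count_mem false w = a by case: P.
  rewrite -Ea -ow; apply: deflation_descent => //.
  + exact: supported_top.
  + by rewrite size_cat !size_nseq sw ow Ea addnC.
  + by rewrite ones_cat /ones !count_nseq /= mul1n mul0n addn0.
  + exact: top_above.
Qed.
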